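(* Let $A=[A_1,\dots,A_n]\in\mathbb{R}^{N\times N}$ with $A_i\in\mathbb{R}^{N\times d_i}$, $\sum_{i=1}^n d_i=N$, be a non-singular square matrix, and let $b\in\mathbb{R}^N$. Let $y^k=[x^k;\mu^k]\in\mathbb{R}^{2N}$ be the iterates after $k$ rounds of Bernoulli-randomized ADMM (BR-ADMM, defined in the context, with $\beta=1$) applied to the problem $\min_{x\in\mathbb{R}^N}0$ subject to $A_1x_1+\cdots+A_nx_n=b$, started from an arbitrary (deterministic) initial point $y^0$. Then the expected output converges to the unique primal-dual optimal solution of the problem, i.e. $\lim_{k\to\infty}E(y^k)=\begin{bmatrix}A^{-1}b\\0\end{bmatrix}$.
   Context: Write $x=[x_1;\dots;x_n]$ with $x_i\in\mathbb{R}^{d_i}$, and $\mu\in\mathbb{R}^N$. The augmented Lagrangian (with $\beta=1$) is $\mathcal{L}(x_1,\dots,x_n;\mu)=-\mu^T(Ax-b)+\frac12\|Ax-b\|^2$. ''Updating $x_i$'' means replacing the current $x_i$ by the minimizer of $\mathcal{L}$ over $x_i\in\mathbb{R}^{d_i}$ with all other blocks and $\mu$ fixed at their current values. BR-ADMM: each round consists of the following. Set $c_i=0$ for $i=1,\dots,n$. Phase I: for $i=1,2,\dots,n$ in this order, draw an independent fair coin $\xi\in\{0,1\}$ ($\Pr(\xi=1)=\Pr(\xi=0)=1/2$); if $\xi=1$, set $c_i=1$ and update $x_i$; if $\xi=0$, do nothing. Phase II: for $i=n,n-1,\dots,1$ in this order, if $c_i=0$, update $x_i$. Finally, dual update: $\mu\leftarrow\mu-(\sum_{i=1}^nA_ix_i-b)$.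 Coins in different rounds are independent. The primal-dual optimal solution of the problem is $(x,\mu)=(A^{-1}b,0)$. *)

(* Defs.v *)
From HB Require Import structures.
From mathcomp Require Import all_boot all_order all_algebra.
From mathcomp Require Import all_classical all_reals all_analysis.
From mathcomp Require Import ring lra.

Set Implicit Arguments.
Unset Strict Implicit.
Unset Printing Implicit Defensive.

Import Order.TTheory GRing.Theory Num.Theory.
Import numFieldNormedType.Exports.

Local Open Scope classical_set_scope.
Local Open Scope ring_scope.

(* A vector of R^N, N = d_1 + ... + d_n, is a column of height
   \sum_(i < n) d i; its i-th block is [submxcol x i].  Block indices are
   0-based.  Norms on matrices in MathComp-Analysis are sup norms, so the
   Euclidean norm is written through [dotc]. *)

Section BlockProblem.
Variables (R : realType) (n : nat) (d : 'I_n -> nat).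
Local Notation N := (\sum_(i < n) d i)%N.
Variables (A_ : forall i : 'I_n, 'M[R]_(N, d i)) (b : 'cV[R]_N).

Definition dotc m (u v : 'cV[R]_m) : R := (u^T *m v) ord0 ord0.

Definition residual (x : 'cV[R]_N) : 'cV[R]_N :=
  \sum_(i < n) A_ i *m submxcol x i - b.

Definition lagrangian (x mu : 'cV[R]_N) : R := - dotc mu (residual x).

Definition aug_lagrangian (x mu : 'cV[R]_N) : R :=
  - dotc mu (residual x) + 2^-1 * dotc (residual x) (residual x).

Definition set_block (x : 'cV[R]_N) (i : 'I_n) (v : 'cV[R]_(d i)) : 'cV[R]_N :=
  \mxcol_j eqtype.dfwith (submxcol x) v j.

Definition block_minimizers (x mu : 'cV[R]_N) (i : 'I_n) :
    set ('cV[R]_(d i)) :=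
  [set v | forall w : 'cV[R]_(d i), aug_lagrangian (set_block x v) mu
                     <= aug_lagrangian (set_block x w) mu].

(* The default value of [xget] is irrelevant for non-singular
   A = [A_1, ..., A_n]: by [block_minimizers_total], there is then exactly one
   minimizer. *)
Definition update (s : 'cV[R]_N * 'cV[R]_N) (i : 'I_n) :
    'cV[R]_N * 'cV[R]_N :=
  (set_block s.1 (xget 0 (@block_minimizers s.1 s.2 i)), s.2).

Definition dual_update (s : 'cV[R]_N * 'cV[R]_N) : 'cV[R]_N * 'cV[R]_N :=
  (s.1, s.2 - residual s.1).

(* One round, given its coins [xi]; at the end of the forward sweep the flag
   c_i is 1 exactly when [xi i] is true. *)
Definition phase1 (xi : 'I_n -> bool) (s : 'cV[R]_N * 'cV[R]_N) :=
  foldl (fun s i => if xi i then update s i else s) s (enum 'I_n).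

Definition phase2 (xi : 'I_n -> bool) (s : 'cV[R]_N * 'cV[R]_N) :=
  foldl (fun s i => if ~~ xi i then update s i else s) s (rev (enum 'I_n)).

Definition br_round (xi : 'I_n -> bool) (s : 'cV[R]_N * 'cV[R]_N) :=
  dual_update (phase2 xi (phase1 xi s)).

Fixpoint br_admm (xi : nat -> 'I_n -> bool) (s0 : 'cV[R]_N * 'cV[R]_N)
    (k : nat) : 'cV[R]_N * 'cV[R]_N :=
  if k is k'.+1 then br_round (xi k') (br_admm xi s0 k') else s0.

(* The problem min 0 subject to A_1 x_1 + ... + A_n x_n = b. *)
Definition objective (x : 'cV[R]_N) : R := 0.

Definition feasible (x : 'cV[R]_N) : Prop :=
  \sum_(i < n) A_ i *m submxcol x i = b.

Definition primal_optimal (x : 'cV[R]_N) : Prop :=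
  feasible x /\ forall x', feasible x' -> objective x <= objective x'.

Definition dual_function (mu : 'cV[R]_N) : \bar R :=
  ereal_inf [set (objective x + lagrangian x mu)%:E | x in setT].

Definition dual_optimal (mu : 'cV[R]_N) : Prop :=
  forall mu', (dual_function mu' <= dual_function mu)%E.

Definition primal_dual_optimal : set ('cV[R]_N * 'cV[R]_N) :=
  [set s | primal_optimal s.1 /\ dual_optimal s.2].

End BlockProblem.

Section Wellposedness.
Variables (R : realType) (n : nat) (d : 'I_n -> nat).
Local Notation N := (\sum_(i < n) d i)%N.
Variables (A_ : forall i : 'I_n, 'M[R]_(N, d i)) (b : 'cV[R]_N).

Lemma dotcC m (u v : 'cV[R]_m) : dotc u v = dotc v u.
Proof. by rewrite /dotc !mxE; apply: eq_bigr => j _; rewrite !mxE mulrC. Qed.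

Lemma dotcDl m (u v w : 'cV[R]_m) : dotc (u + v) w = dotc u w + dotc v w.
Proof. by rewrite /dotc linearD mulmxDl mxE. Qed.

Lemma dotcNl m (u v : 'cV[R]_m) : dotc (- u) v = - dotc u v.
Proof. by rewrite /dotc linearN mulNmx mxE. Qed.

Lemma dotcDr m (u v w : 'cV[R]_m) : dotc u (v + w) = dotc u v + dotc u w.
Proof. by rewrite dotcC dotcDl !(dotcC _ u). Qed.

Lemma dotc_sqE m (u : 'cV[R]_m) : dotc u u = \sum_j u j ord0 ^+ 2.
Proof. by rewrite /dotc mxE; apply: eq_bigr => j _; rewrite mxE expr2. Qed.

Lemma dotc_ge0 m (u : 'cV[R]_m) : 0 <= dotc u u.
Proof. by rewrite dotc_sqE; apply: sumr_ge0 => j _; exact: sqr_ge0. Qed.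

Lemma dotc_eq0 m (u : 'cV[R]_m) : dotc u u = 0 -> u = 0.
Proof.
rewrite dotc_sqE => /psumr_eq0P h; apply/colP => j; rewrite mxE.
by apply/eqP; rewrite -sqrf_eq0; apply/eqP/h => // k _; exact: sqr_ge0.
Qed.

Lemma complete_square m (p q u : 'cV[R]_m) : dotc q p = dotc q u ->
  - dotc u (p + q) + 2^-1 * dotc (p + q) (p + q)
  = - dotc u p + 2^-1 * dotc p p + 2^-1 * dotc q q.
Proof.
move=> qp; rewrite !dotcDr !dotcDl (dotcC p q) (dotcC u q) qp.
move: (dotc u p) (dotc q u) (dotc p p) (dotc q q) => a c e f; lra.
Qed.

Lemma submxcol_set_block (x : 'cV[R]_N) i (v : 'cV[R]_(d i)) :
  submxcol (set_block x v) i = v.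
Proof. by rewrite mxcolK eqtype.dfwith_in. Qed.

Lemma residual_set_block x i (v : 'cV[R]_(d i)) :
  residual A_ b (set_block x v) =
  A_ i *m v + residual A_ b (set_block x (0 : 'cV[R]_(d i))).
Proof.
rewrite /residual addrA; congr (_ - _).
rewrite [LHS](bigD1 i)//= [X in _ = _ + X](bigD1 i)//= !submxcol_set_block mulmx0 add0r.
congr (_ + _); apply: eq_bigr => j ji.
by rewrite !mxcolK !eqtype.dfwith_out// eq_sym.
Qed.

Hypothesis hA : \mxrow_i A_ i \in unitmx.

Lemma block_inj i (u : 'cV[R]_(d i)) : A_ i *m u = 0 -> u = 0.
Proof.
move=> Au0; have : set_block 0 u = 0.
  rewrite -[LHS](mulKmx hA) /set_block mul_mxrow_mxcol [X in _ *m X](bigD1 i)//=.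
  rewrite eqtype.dfwith_in Au0 add0r [X in _ *m X]big1 ?mulmx0// => j ji.
  rewrite eqtype.dfwith_out 1?eq_sym//.
  suff -> : submxcol (0 : 'cV[R]_N) j = 0 by rewrite mulmx0.
  by apply/matrixP => a c; rewrite !mxE.
move=> /(congr1 (fun y => submxcol y i)); rewrite submxcol_set_block => ->.
by apply/matrixP => a c; rewrite !mxE.
Qed.

Lemma gram_unit i : (A_ i)^T *m A_ i \in unitmx.
Proof.
rewrite -row_free_unit; apply: inj_row_free => w wG.
have : dotc (A_ i *m w^T) (A_ i *m w^T) = 0.
  by rewrite /dotc trmx_mul trmxK -mulmxA [X in _ *m X]mulmxA mulmxA wG
    mul0mx mxE.
by move=> /dotc_eq0/block_inj/(congr1 trmx); rewrite trmxK trmx0.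
Qed.

Lemma block_minimizers_total x mu i :
  exists! v : 'cV[R]_(d i), block_minimizers A_ b x mu v.
Proof.
pose r := residual A_ b (set_block x (0 : 'cV[R]_(d i))).
pose vs := invmx ((A_ i)^T *m A_ i) *m ((A_ i)^T *m (mu - r)).
have Lvs v : aug_lagrangian A_ b (set_block x v) mu =
    aug_lagrangian A_ b (set_block x vs) mu
    + 2^-1 * dotc (A_ i *m (v - vs)) (A_ i *m (v - vs)).
  rewrite /aug_lagrangian (residual_set_block x v) (residual_set_block x vs) -/r.
  pose p : 'cV[R]_N := A_ i *m vs + r.
  rewrite -/p; set q := A_ i *m (v - vs).
  have -> : A_ i *m v + r = p + q.
    by rewrite (addrC p q) /q mulmxBr /p [RHS]addrA subrK.
  have qp : dotc q p = dotc q mu.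
    apply/eqP; rewrite -subr_eq0 dotcC [dotc q mu]dotcC -dotcNl -dotcDl.
    have pE : p - mu = A_ i *m vs + (r - mu) by rewrite addrA.
    have Gp : (A_ i)^T *m (p - mu) = 0.
      rewrite pE mulmxDr mulmxA mulKVmx ?gram_unit//.
      by rewrite -mulmxDr addrA subrK subrr mulmx0.
    by rewrite dotcC /dotc {1}/q trmx_mul -mulmxA Gp mulmx0 mxE.
  exact: complete_square.
exists vs; split=> [w|v vmin].
  by rewrite (Lvs w) lerDl mulr_ge0 ?invr_ge0 ?ler0n ?dotc_ge0.
have : dotc (A_ i *m (v - vs)) (A_ i *m (v - vs)) = 0.
  apply/eqP; rewrite eq_le dotc_ge0 andbT.
  have := vmin vs; rewrite (Lvs v) gerDl.
  by rewrite pmulr_rle0 ?invr_gt0 ?ltr0n.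
by move=> /dotc_eq0/block_inj/eqP; rewrite subr_eq0 => /eqP.
Qed.

End Wellposedness.

Section Randomness.
Context {disp : measure_display} {T : measurableType disp} {R : realType}.
Variable P : probability T R.

Definition mutually_independent (I : choiceType) dS
    (S : measurableType dS) (X : I -> T -> S) : Prop :=
  forall (J : seq I) (B : I -> set S), uniq J ->
    (forall j, measurable (B j)) ->
    P (\bigcap_(j in [set` J]) (X j @^-1` B j))
    = (\prod_(j <- J) P (X j @^-1` B j))%E.

Definition fair_coin (X : T -> bool) : Prop :=
  P (X @^-1` [set true]) = (2^-1)%:E /\ P (X @^-1` [set false]) = (2^-1)%:E.

(* Meaningful when all the coordinates are integrable, which holds for the
   iterates: see [br_admm_integrable]. *)
Definition expectation_vec m (Y : T -> 'cV[R]_m) : 'cV[R]_m :=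
  \col_j fine 'E_P[fun w => Y w j ord0].

End Randomness.

Section Integrability.
Variables (R : realType) (n : nat) (d : 'I_n -> nat).
Local Notation N := (\sum_(i < n) d i)%N.
Variables (A_ : forall i : 'I_n, 'M[R]_(N, d i)) (b : 'cV[R]_N).
Context {disp : measure_display} {T : measurableType disp}.
Variable P : probability T R.
Variable xi : nat -> 'I_n -> {RV P >-> bool}.

Lemma eq_br_admm (c c' : nat -> 'I_n -> bool) s0 k :
  (forall l i, (l < k)%N -> c l i = c' l i) ->
  br_admm A_ b c s0 k = br_admm A_ b c' s0 k.
Proof.
elim: k => // k IH h /=; rewrite IH; last by move=> l i lk; rewrite h// ltnW.
by congr br_round; apply/funext => i; rewrite h.
Qed.

Definition coin_history k (w : T) : {ffun 'I_k * 'I_n -> bool} :=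
  [ffun li : 'I_k * 'I_n => xi li.1 li.2 w].

Lemma measurable_coin_history k c : measurable (coin_history k @^-1` [set c]).
Proof.
have -> : coin_history k @^-1` [set c] =
    \bigcap_(li in [set: 'I_k * 'I_n]) (xi li.1 li.2 @^-1` [set c li]).
  apply/seteqP; split => w /=.
    by move=> <- li _; rewrite /= ffunE.
  by move=> h; apply/ffunP => li; rewrite ffunE; exact: (h li).
apply: fin_bigcap_measurable => // li _.
by rewrite -[X in measurable X]setTI; exact: measurable_funPT.
Qed.

Lemma br_admm_integrable s0 k (j : 'I_(N + N)) :
  P.-integrable setT (EFin \o fun w =>
    let s := br_admm A_ b (fun l i => xi l i w) s0 k in
    col_mx s.1 s.2 j ord0).
Proof.
pose g (c : {ffun 'I_k * 'I_n -> bool}) : R :=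
  let s := br_admm A_ b
    (fun l i => if insub l is Some l' then c (l', i) else false) s0 k in
  col_mx s.1 s.2 j ord0.
rewrite (_ : _ \o _ = EFin \o (g \o coin_history k)); last first.
  apply/funext => w /=; rewrite /g /=; congr EFin.
  suff -> : br_admm A_ b (fun l i => xi l i w) s0 k = br_admm A_ b (fun l i =>
      if insub l is Some l' then coin_history k w (l', i) else false) s0 k by [].
  by apply: eq_br_admm => l i lk; rewrite insubT ffunE.
apply: measurable_bounded_integrable => //.
- by rewrite (@le_lt_trans _ _ 1%E) ?probability_le1 ?ltry.
- move=> _ B _; rewrite setTI.
  have -> : (g \o coin_history k) @^-1` B =
      \bigcup_(c in [set c | B (g c)]) (coin_history k @^-1` [set c]).
    apply/seteqP; split => w /=; first by move=> Bw; exists (coin_history k w).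
    by case=> c Bc /= ->.
  apply: fin_bigcup_measurable => // c _; exact: measurable_coin_history.
- exists (\sum_c `|g c|); split; first by rewrite num_real.
  move=> M ltM w _ /=; apply: le_trans (ltW ltM).
  by rewrite (bigD1 (coin_history k w))//= lerDl sumr_ge0.
Qed.

End Integrability.

(* Main.v *)
Require Import Defs.
From HB Require Import structures.
From mathcomp Require Import all_boot all_order all_algebra.
From mathcomp Require Import all_classical all_reals all_analysis.
From mathcomp Require Import ring lra.
Import Order.TTheory GRing.Theory Num.Theory.
Import numFieldNormedType.Exports.
Local Open Scope classical_set_scope.
Local Open Scope ring_scope.

Set Implicit Arguments.
Unset Strict Implicit.
Unset Printing Implicit Defensive.

(** Write [u = r - mu], where [r] is the residual of the current primal point.
    The minimizer over block [i] makes [A_i^T u = 0] and moves [u] by an element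
    of the range of [A_i], so updating block [i] replaces [u] by [K_i u], where
    [K_i] is the orthogonal projection onto the kernel of [A_i^T]
    ([gap_update]). With fixed coins, a round thus multiplies [u] by a product
    [T] of all the [K_i], each taken once, and after the dual update sends
    [(u, mu)] to [(mu + 2 T u, - T u)] ([br_round_gap], [br_round_dual]). The
    coins of a round are independent of the past, so the means obey the same
    rule with [T] replaced by its mean [M]; eliminating [mu] leaves
    [u_(k+2) = 2 M u_(k+1) - M u_k] ([mean_gap_step], [mean_dual_step]).

    The first coin decides whether block 1 is updated first or last, so [M] is
    built by symmetrized products: prepending a block [i] replaces [M] by
    [(M K_i + K_i M) / 2] ([sum_sweep_mx]). This makes [M] symmetric and
    nonexpansive, and an induction on the blocks gives [M > - 1/3]
    ([mean_sweep_lower]). A vector [v] with [<v, M v> = |v|^2] is fixed by every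
    [K_i], hence orthogonal to all the columns of [A], hence zero: [M < 1]
    ([dotc_mean_mx_lt]).

    An eigenvalue [t] of [M] contributes the characteristic polynomial
    [z^2 - 2 t z + t], whose roots lie in the open unit disc exactly when
    [- 1/3 < t < 1]. No diagonalization is made: the quadratic form
    [|u|^2 + |u'|^2 + <u, M u> + <u', M u'> - 4 <u, M u'>] of consecutive terms
    is nonnegative and drops at each step by [<e, (1 - M) e>], where
    [e = u_(k+2) - u_k]; therefore [e] tends to 0, and the invertibility of
    [1 - M] and of [1 + 3 M] brings [u] to 0 ([two_step_cvg0]). The mean
    multiplier is then [- M u], which tends to 0, and the mean primal point is
    [A^-1 (b + u + mu)], which tends to [A^-1 b]. *)

(** * Symmetric and nonexpansive matrices *)

Section InnerProduct.
Variables (R : realType) (m : nat).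
Implicit Types (u v w : 'cV[R]_m) (B K : 'M[R]_m).

Lemma dotcNr u v : dotc u (- v) = - dotc u v.
Proof. by rewrite dotcC dotcNl dotcC. Qed.

Lemma dotcZl a u v : dotc (a *: u) v = a * dotc u v.
Proof. by rewrite /dotc linearZ/= -scalemxAl mxE. Qed.

Lemma dotcZr a u v : dotc u (a *: v) = a * dotc u v.
Proof. by rewrite dotcC dotcZl dotcC. Qed.

Definition dotcE :=
  (@dotcDl R m, @dotcDr R m, @dotcNl R m, dotcNr, dotcZl, dotcZr).

Lemma dotc_gt0 u : u != 0 -> 0 < dotc u u.
Proof.
move=> u0; rewrite lt_neqAle dotc_ge0 andbT eq_sym.
by apply: contra u0 => /eqP/dotc_eq0 ->.
Qed.

Lemma dotc_mulmxl k (B : 'M[R]_(k, m)) (u : 'cV[R]_m) (v : 'cV[R]_k) :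
  dotc (B *m u) v = dotc u (B^T *m v).
Proof. by rewrite /dotc trmx_mul mulmxA. Qed.

Lemma dotc_symmx B u v : B^T = B -> dotc u (B *m v) = dotc (B *m u) v.
Proof. by move=> Bs; rewrite dotc_mulmxl Bs. Qed.

Lemma unitmx_of_dotc_gt0 B :
  (forall v, v != 0 -> 0 < dotc v (B *m v)) -> B \in unitmx.
Proof.
move=> Bpos; rewrite -unitmx_tr -row_free_unit; apply: inj_row_free => w wB.
apply/eqP/negPn/negP => w0; have /Bpos : w^T != 0.
  by apply: contra w0 => /eqP/(congr1 trmx); rewrite trmxK trmx0 => ->.
rewrite -[B]trmxK -trmx_mul wB.
by rewrite trmx0 /dotc mulmx0 mxE ltxx.
Qed.

Definition orthoproj K := K^T = K /\ K *m K = K.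

(** Pythagoras for the range of [K] and its orthogonal complement. *)
Lemma orthoproj_split K v : orthoproj K ->
  dotc v v = dotc (K *m v) (K *m v) + dotc (v - K *m v) (v - K *m v).
Proof.
move=> [Ks KK]; rewrite !dotcE (dotc_mulmxl K v v) (dotc_mulmxl K v (K *m v)).
rewrite mulmxA Ks KK.
ring.
Qed.

Definition nonexpansive B := forall v, dotc (B *m v) (B *m v) <= dotc v v.

Lemma orthoproj_nonexpansive K : orthoproj K -> nonexpansive K.
Proof.
by move=> hK v; rewrite [leRHS](orthoproj_split _ hK) lerDl dotc_ge0.
Qed.

(** A projection that does not shorten [v] fixes it: by Pythagoras, the
    component of [v] outside the range of [K] has norm zero. *)
Lemma orthoproj_fix K v : orthoproj K ->
  dotc v v <= dotc (K *m v) (K *m v) -> K *m v = v.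
Proof.
move=> hK; rewrite [leLHS](orthoproj_split _ hK) gerDl => le0.
have /dotc_eq0/eqP : dotc (v - K *m v) (v - K *m v) = 0.
  by apply/eqP; rewrite eq_le le0 dotc_ge0.
by rewrite subr_eq0 => /eqP.
Qed.

Lemma nonexpansive_mul B C : nonexpansive B -> nonexpansive C ->
  nonexpansive (B *m C).
Proof. by move=> hB hC v; rewrite -mulmxA (le_trans (hB _))// hC. Qed.

(** Follows from the parallelogram law
    [|Bv + Cv|^2 + |Bv - Cv|^2 = 2 |Bv|^2 + 2 |Cv|^2]. *)
Lemma nonexpansive_mean B C : nonexpansive B -> nonexpansive C ->
  nonexpansive (2^-1 *: (B + C)).
Proof.
move=> hB hC v; have := hB v; have := hC v.
have := dotc_ge0 (B *m v - C *m v).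
rewrite -scalemxAl mulmxDl !dotcE (dotcC (C *m v) (B *m v)).
lra.
Qed.

Lemma dotc_le_nonexpansive B v : nonexpansive B -> dotc v (B *m v) <= dotc v v.
Proof.
move=> hB; have := hB v; have := dotc_ge0 (v - B *m v).
rewrite !dotcE (dotcC (B *m v) v); lra.
Qed.

End InnerProduct.

(** * The mean of the product of projections over a random sweep *)

Section MeanSweep.
Variables (R : realType) (m : nat) (I : eqType) (K : I -> 'M[R]_m).
Hypothesis hK : forall i, orthoproj (K i).
Implicit Types (l : seq I) (v : 'cV[R]_m).

(** For an independent fair coin per element of [i :: l], the element [i] acts
    either before or after all of [l], with probability 1/2 each. *)
Fixpoint mean_sweep l : 'M[R]_m :=
  if l is i :: l' then
    2^-1 *: (mean_sweep l' *m K i + K i *m mean_sweep l')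
  else 1%:M.

Lemma trmx_mean_sweep l : (mean_sweep l)^T = mean_sweep l.
Proof.
elim: l => [|i l IH] /=; first exact: trmx1.
by rewrite linearZ/= linearD/= !trmx_mul IH (hK i).1 addrC.
Qed.

Lemma mean_sweep_nonexpansive l : nonexpansive (mean_sweep l).
Proof.
elim: l => [v|i l IH] /=; first by rewrite mul1mx.
have Ki := orthoproj_nonexpansive (hK i).
by apply: nonexpansive_mean; exact: nonexpansive_mul.
Qed.

(** The two halves of the symmetrized product have the same quadratic form, as
    both factors are symmetric. *)
Lemma dotc_mean_sweep_cons i l v : dotc v (mean_sweep (i :: l) *m v) =
  dotc (K i *m v) (mean_sweep l *m v).
Proof.
rewrite /= -scalemxAl mulmxDl -!mulmxA !dotcE.
rewrite (dotc_symmx v (K i *m v) (trmx_mean_sweep l)) (dotc_symmx v _ (hK i).1).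
rewrite (dotcC (mean_sweep l *m v)).
lra.
Qed.

(** Equality in the nonexpansive bound propagates: from
    [<K_i v, M v> >= |v|^2], [|K_i v| <= |v|] and [|M v| <= |v|] it follows that
    [K_i v = v], and then [v] is again an equality case for the remaining
    factors. *)
Lemma mean_sweep_fix l v : dotc v v <= dotc v (mean_sweep l *m v) ->
  forall i, i \in l -> K i *m v = v.
Proof.
elim: l => // i l IH; rewrite dotc_mean_sweep_cons => le_v.
have Kiv : K i *m v = v.
  apply: (orthoproj_fix (hK i)).
  have := mean_sweep_nonexpansive l v.
  have := dotc_ge0 (K i *m v - mean_sweep l *m v).
  rewrite !dotcE (dotcC (mean_sweep l *m v)).
  lra.
move=> j; rewrite inE => /predU1P[-> //|]; apply: IH.
by rewrite -{3}Kiv.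
Qed.

(** The mean sweep is larger than [- 1/3]. Split [v = p + q] with [p = K_i v];
    prepending [i] gives the form [<p, M p> + <p, M q>], which is
    [<w, M w> - <q, M q> / 4] for [w = p + q / 2]. Hence [|v|^2 + 3 <p, M v>] is
    the sum of [|w|^2 + 3 <w, M w>], positive by induction, and of
    [3/4 (|q|^2 - <q, M q>)]. *)
Lemma mean_sweep_lower l v : v != 0 ->
  0 < dotc v v + 3 * dotc v (mean_sweep l *m v).
Proof.
elim: l v => [|i l IH] v v0.
  by rewrite /= mul1mx; have := dotc_gt0 v0; lra.
rewrite dotc_mean_sweep_cons (orthoproj_split v (hK i)).
set p := K i *m v; set q := v - p.
have pq : dotc p q = 0.
  rewrite /p dotc_mulmxl (hK i).1 /q mulmxBr mulmxA (hK i).2 subrr.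
  by rewrite /dotc mulmx0 mxE.
have vE : v = p + q by rewrite /q addrC subrK.
rewrite vE; clearbody q p; pose w := p + 2^-1 *: q.
have w0 : w != 0.
  apply: contra v0 => /eqP w0.
  have : dotc w w = 0 by rewrite w0 /dotc mulmx0 mxE.
  rewrite /w !dotcE (dotcC q p) pq => wE.
  have pp := dotc_ge0 p; have qq := dotc_ge0 q.
  have /dotc_eq0 p0 : dotc p p = 0 by lra.
  have /dotc_eq0 q0 : dotc q q = 0 by lra.
  by rewrite vE p0 q0 addr0.
have := IH w w0.
have := dotc_le_nonexpansive q (mean_sweep_nonexpansive l).
have sy : dotc q (mean_sweep l *m p) = dotc p (mean_sweep l *m q).
  by rewrite -{1}(trmx_mean_sweep l) -dotc_mulmxl dotcC.
have := dotc_ge0 q.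
rewrite /w !mulmxDr -!scalemxAr !dotcE (dotcC q p) pq sy.
lra.
Qed.

End MeanSweep.

(** * Convergence of the two-step recurrence *)

Section TwoStepRecurrence.
Variables (R : realType) (m : nat).

Lemma cvg_mx_coord (m1 m2 : nat) (f : nat -> 'M[R]_(m1, m2))
    (l : 'M[R]_(m1, m2)) :
  (forall i j, f k i j @[k --> \oo] --> l i j) -> f k @[k --> \oo] --> l.
Proof.
move=> h; apply/cvg_ballP => e e0.
have : \forall k \near \oo, forall ij : 'I_m1 * 'I_m2,
    ball (l ij.1 ij.2) e (f k ij.1 ij.2).
  apply: (filter_forall _) => -[i j] /=.
  by have /cvg_ballP/(_ e e0) := h i j.
by apply: filterS => k hk; split => // i j; exact: hk (i, j).
Qed.

Lemma cvg_mulmxl (m1 m2 m3 : nat) (B : 'M[R]_(m1, m2))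
    (f : nat -> 'M[R]_(m2, m3)) (l : 'M[R]_(m2, m3)) :
  f k @[k --> \oo] --> l -> B *m f k @[k --> \oo] --> B *m l.
Proof.
move=> fl; apply: cvg_mx_coord => i j; rewrite mxE.
under eq_fun do rewrite mxE.
apply: cvg_big => [|c _]; first exact: add_continuous.
apply: cvgMr; apply: (cvg_comp f (fun M : 'M[R]_(m2, m3) => M c j) fl).
exact: coord_continuous.
Qed.

Lemma cvg0_of_dotc (f : nat -> 'cV[R]_m) :
  dotc (f k) (f k) @[k --> \oo] --> (0 : R) ->
  f k @[k --> \oo] --> (0 : 'cV[R]_m).
Proof.
move=> h; apply: cvg_mx_coord => i j; rewrite mxE ord1.
apply/cvgr0Pnorm_lt => e e0.
have e20 : 0 < e ^+ 2 by rewrite exprn_gt0.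
move/cvgr0Pnorm_lt: h => /(_ _ e20).
apply: filterS => k; rewrite ger0_norm ?dotc_ge0// dotc_sqE => lt_e.
rewrite -ltr_sqr ?nnegrE ?(ltW e0)// real_normK ?num_real//.
apply: le_lt_trans lt_e; rewrite (bigD1 i)//= lerDl.
by apply: sumr_ge0 => *; exact: sqr_ge0.
Qed.

(** [Slower] and [Supper] place the eigenvalues [t] of [S] in ]- 1/3, 1[, the
    interval where both roots of [z^2 - 2 t z + t] have modulus less than 1. *)
Variables (S : 'M[R]_m) (u : nat -> 'cV[R]_m).
Hypotheses (ST : S^T = S) (Sle : nonexpansive S).
Hypothesis Slower : forall v, v != 0 -> 0 < dotc v v + 3 * dotc v (S *m v).
Hypothesis Supper : forall v, v != 0 -> dotc v (S *m v) < dotc v v.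
Hypothesis uE : forall k, u k.+2 = 2 *: (S *m u k.+1) - S *m u k.

(** Up to the factor [1 - t], the Schur-Cohn form of [z^2 - 2 t z + t] with [S]
    in place of [t]. *)
Definition energy (a c : 'cV[R]_m) := dotc a a + dotc a (S *m a) + dotc c c
  + dotc c (S *m c) - 4 * dotc a (S *m c).

(** The energy is half the sum of the forms of [1 - S] at [a + c] and of
    [1 + 3 S] at [a - c]. *)
Lemma energy_ge0 a c : 0 <= energy a c.
Proof.
have := dotc_le_nonexpansive (a + c) Sle.
have : 0 <= dotc (a - c) (a - c) + 3 * dotc (a - c) (S *m (a - c)).
  have [->|/Slower/ltW//] := eqVneq (a - c) 0.
  by rewrite mulmx0 /dotc mulmx0 mxE mulr0 addr0.
have ca : dotc c (S *m a) = dotc a (S *m c).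
  by rewrite -{1}ST -dotc_mulmxl dotcC.
rewrite /energy !mulmxDr mulmxN !dotcE ca (dotcC c a).
lra.
Qed.

(** The cross terms of the drop combine into [4 <e, S u_(k+1)>] with
    [e = u_(k+2) - u_k], and the recurrence gives
    [2 S u_(k+1) = u_(k+2) + S u_k]. *)
Lemma energy_decrease k : energy (u k) (u k.+1) - energy (u k.+1) (u k.+2) =
  dotc (u k.+2 - u k) (u k.+2 - u k)
  - dotc (u k.+2 - u k) (S *m (u k.+2 - u k)).
Proof.
have := uE k; move: (u k) (u k.+1) (u k.+2) => a c e eE.
have sw x y : dotc x (S *m y) = dotc y (S *m x).
  by rewrite -{1}ST -dotc_mulmxl dotcC.
have key : dotc (e - a) (e + S *m a) = 2 * dotc (e - a) (S *m c).
  by rewrite {2}eE subrK dotcZr.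
move: key; rewrite /energy !mulmxDr mulmxN !dotcE.
rewrite (sw e c) (sw e a) (dotcC e a).
lra.
Qed.

(** With this bound, [(1 - S) v] tends to 0 as soon as [<v, (1 - S) v>] does,
    without a positive lower bound on [1 - S]. *)
Lemma nonexpansive_sub_sq v :
  dotc ((1%:M - S) *m v) ((1%:M - S) *m v) <= 2 * (dotc v v - dotc v (S *m v)).
Proof.
have := Sle v; rewrite mulmxBl mul1mx !dotcE (dotcC (S *m v)); lra.
Qed.

(** The energy is nonincreasing and nonnegative, so its drops tend to 0, and so
    does [dlt = u_(k+2) - u_k]. The recurrence expresses
    [(1 - S) (u_k + u_(k+1))] and [(1 + 3 S) (u_k - u_(k+1))] through [dlt], and
    both matrices are invertible. *)
Lemma two_step_cvg0 : u k @[k --> \oo] --> (0 : 'cV[R]_m).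
Proof.
have U1 : 1%:M - S \in unitmx.
  apply: unitmx_of_dotc_gt0 => v /Supper.
  by rewrite mulmxBl mul1mx !dotcE subr_gt0.
have U3 : 1%:M + 3 *: S \in unitmx.
  apply: unitmx_of_dotc_gt0 => v /Slower.
  by rewrite mulmxDl mul1mx -scalemxAl !dotcE.
pose E k := energy (u k) (u k.+1).
have ES k : E k - E k.+1 = _ := energy_decrease k.
have Ecvg : cvgn E.
  apply: nonincreasing_is_cvgn.
    apply/nonincreasing_seqP => k; rewrite -subr_ge0 ES subr_ge0.
    exact: dotc_le_nonexpansive.
  by exists 0 => _ [k _ <-]; exact: energy_ge0.
pose dlt k := u k.+2 - u k.
have d0 : dlt k @[k --> \oo] --> (0 : 'cV[R]_m).
  have -> : dlt = fun k => invmx (1%:M - S) *m ((1%:M - S) *m dlt k).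
    by apply/funext => k; rewrite mulKmx.
  rewrite -[X in _ --> X](mulmx0 _ (invmx (1%:M - S))); apply: cvg_mulmxl.
  apply: cvg0_of_dotc.
  have E0 : 2 * (E k - E k.+1) @[k --> \oo] --> (0 : R).
    rewrite -[X in _ --> X](mulr0 2); apply: cvgMr.
    rewrite -(subrr (limn E)); apply: cvgB => //.
    by rewrite (cvg_shiftS E).
  apply: (squeeze_cvgr _ (cvg_cst (0 : R)) E0).
  apply: nearW => k; rewrite dotc_ge0 /= ES; exact: nonexpansive_sub_sq.
have d0S : dlt k.+1 @[k --> \oo] --> (0 : 'cV[R]_m) by rewrite (cvg_shiftS dlt).
have Sd k : S *m dlt k = 2 *: (S *m (S *m u k.+1)) - S *m (S *m u k) - S *m u k.
  by rewrite /dlt uE !mulmxBr -scalemxAr.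
have uu k : u k.+3 = 2 *: (2 *: (S *m (S *m u k.+1)) - S *m (S *m u k))
    - S *m u k.+1.
  by rewrite uE uE mulmxBr -scalemxAr.
have sum0 : u k + u k.+1 @[k --> \oo] --> (0 : 'cV[R]_m).
  have -> : (fun k => u k + u k.+1) = fun k =>
      invmx (1%:M - S) *m (2 *: S *m dlt k - dlt k - dlt k.+1).
    apply/funext => k; apply: (canRL (mulKmx U1)).
    rewrite mulmxBl mul1mx mulmxDr -scalemxAl Sd /dlt uu uE.
    move: (S *m (S *m u k)) (S *m (S *m u k.+1)) (S *m u k) (S *m u k.+1).
    by move=> ? ? ? ?; apply/colP => i; rewrite !mxE; ring.
  have h : 2 *: S *m dlt k - dlt k - dlt k.+1 @[k --> \oo] -->
      (2 *: S *m 0 - 0 - 0 : 'cV[R]_m).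
    by apply: cvgB => //; apply: cvgB => //; exact: cvg_mulmxl.
  have := cvg_mulmxl (B := invmx (1%:M - S)) h.
  by rewrite mulmx0 !subr0 mulmx0.
have sub0 : u k - u k.+1 @[k --> \oo] --> (0 : 'cV[R]_m).
  have -> : (fun k => u k - u k.+1) = fun k =>
      invmx (1%:M + 3 *: S) *m (dlt k.+1 - dlt k - 2 *: S *m dlt k).
    apply/funext => k; apply: (canRL (mulKmx U3)).
    rewrite mulmxDl mul1mx mulmxBr -!scalemxAl Sd /dlt uu uE.
    move: (S *m (S *m u k)) (S *m (S *m u k.+1)) (S *m u k) (S *m u k.+1).
    by move=> ? ? ? ?; apply/colP => i; rewrite !mxE; ring.
  have h : dlt k.+1 - dlt k - 2 *: S *m dlt k @[k --> \oo] -->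
      (0 - 0 - 2 *: S *m 0 : 'cV[R]_m).
    by apply: cvgB; [exact: cvgB|exact: cvg_mulmxl].
  have := cvg_mulmxl (B := invmx (1%:M + 3 *: S)) h.
  by rewrite mulmx0 !subr0 mulmx0.
have -> : u = fun k => (2^-1)%:M *m ((u k + u k.+1) + (u k - u k.+1)).
  apply/funext => k; rewrite mul_scalar_mx; apply/colP => i; rewrite !mxE; lra.
have h : u k + u k.+1 + (u k - u k.+1) @[k --> \oo] --> (0 + 0 : 'cV[R]_m).
  exact: cvgD.
by have := cvg_mulmxl (B := (2^-1)%:M) h; rewrite addr0 mulmx0.
Qed.

End TwoStepRecurrence.

(** * Averaging a sweep over its coins *)

Section SweepMatrix.
Variables (R : realType) (m : nat) (I : finType) (K : I -> 'M[R]_m).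
Implicit Types (e : {ffun I -> bool}) (l : seq I).

(** Factors act on columns, so the rightmost one is applied first: a coin [true]
    places [i] before the elements of [l], a coin [false] after them. *)
Fixpoint sweep_mx e l : 'M[R]_m :=
  if l is i :: l' then
    if e i then sweep_mx e l' *m K i else K i *m sweep_mx e l'
  else 1%:M.

Definition flip i e : {ffun I -> bool} := [ffun j => (j == i) (+) e j].

Lemma flipK i : involutive (flip i).
Proof. by move=> e; apply/ffunP => j; rewrite !ffunE addKb. Qed.

Lemma sweep_mx_flip i e l : i \notin l -> sweep_mx (flip i e) l = sweep_mx e l.
Proof.
elim: l => //= j l IH; rewrite inE negb_or => /andP[ij il].
by rewrite IH// ffunE eq_sym (negbTE ij).
Qed.

(** Flipping the coin of [i] is a bijection that leaves the factors of [l]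
    unchanged, so the coins with [e i] and those without contribute the same sum
    over [l], half of the total. *)
Lemma sum_sweep_mx l : uniq l ->
  \sum_(e : {ffun I -> bool}) sweep_mx e l = (2 ^ #|I|)%:R *: mean_sweep K l.
Proof.
elim: l => [_|i l IH] /=.
  by rewrite sumr_const card_ffun card_bool scaler_nat.
move=> /andP[il /IH {}IH].
pose H := \sum_(e : {ffun I -> bool} | e i) sweep_mx e l.
have HN : \sum_(e : {ffun I -> bool} | ~~ e i) sweep_mx e l = H.
  rewrite (reindex_inj (inv_inj (flipK i)))/=.
  apply: eq_big => [e|e _]; first by rewrite ffunE eqxx/= negbK.
  exact: sweep_mx_flip.
have HH : H = 2^-1 *: ((2 ^ #|I|)%:R *: mean_sweep K l).
  rewrite -IH (bigID (fun e : {ffun I -> bool} => e i))/= HN -/H.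
  by apply/matrixP => a c; rewrite !mxE; lra.
rewrite (bigID (fun e : {ffun I -> bool} => e i))/=.
have -> : \sum_(e : {ffun I -> bool} | e i)
    (if e i then sweep_mx e l *m K i else K i *m sweep_mx e l) = H *m K i.
  by rewrite /H mulmx_suml; apply: eq_bigr => e ->.
have -> : \sum_(e : {ffun I -> bool} | ~~ e i)
    (if e i then sweep_mx e l *m K i else K i *m sweep_mx e l) = K i *m H.
  by rewrite -HN mulmx_sumr; apply: eq_bigr => e /negbTE ->.
rewrite HH.
by rewrite -!scalemxAl -!scalemxAr -!scalerDr !scalerA mulrC.
Qed.

End SweepMatrix.

(** * One round of the algorithm *)

Section Round.
Variables (R : realType) (n : nat) (d : 'I_n -> nat).
Local Notation N := (\sum_(i < n) d i)%N.
Variables (A_ : forall i : 'I_n, 'M[R]_(N, d i)) (b : 'cV[R]_N).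
Hypothesis hA : \mxrow_i A_ i \in unitmx.
Local Notation state := ('cV[R]_N * 'cV[R]_N)%type.
Implicit Types (s : state) (x mu : 'cV[R]_N).

Lemma residualE x : residual A_ b x = \mxrow_i A_ i *m x - b.
Proof. by rewrite -{2}(submxcolK x) mul_mxrow_mxcol. Qed.

Lemma set_block_id x i : set_block x (submxcol x i) = x.
Proof.
rewrite -[RHS]submxcolK; apply: eq_mxcol => j.
by case: eqtype.dfwithP.
Qed.

(** The first-order condition. Along the direction [- g], with [g] the gradient,
    the Lagrangian changes by [- t |g|^2 + t^2 |A_i g|^2 / 2], which is negative
    for some [t] unless [g = 0]. *)
Lemma block_minimizer_stationary x mu i (v : 'cV[R]_(d i)) :
  block_minimizers A_ b x mu v ->
  (A_ i)^T *m (residual A_ b (set_block x v) - mu) = 0.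
Proof.
move=> vmin; set p := residual _ _ _; set g := _ *m _.
have ge0 t : 0 <= - t * dotc g g + t ^+ 2 / 2 * dotc (A_ i *m g) (A_ i *m g).
  have := vmin (v - t *: g); rewrite /aug_lagrangian.
  have -> : residual A_ b (set_block x (v - t *: g)) = p - t *: (A_ i *m g).
    rewrite /p residual_set_block [in RHS]residual_set_block mulmxBr -scalemxAr.
    by rewrite addrAC.
  have gg : dotc g g = dotc (A_ i *m g) p - dotc (A_ i *m g) mu.
    by rewrite {2}/g -dotc_mulmxl dotcDr dotcNr.
  rewrite gg -/p; generalize (A_ i *m g) p => q r.
  rewrite !dotcE (dotcC r q) (dotcC mu q).
  lra.
apply: dotc_eq0; apply/eqP; rewrite eq_le dotc_ge0 andbT leNgt.
apply/negP => g0.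
set be := dotc (A_ i *m g) (A_ i *m g) in ge0.
have be0 : 0 <= be := dotc_ge0 _.
(* The minimum is at [t = |g|^2 / be]; the increment avoids dividing by 0. *)
pose t := dotc g g / (be + 1); have := ge0 t.
have t0 : 0 < t by rewrite divr_gt0// ltr_pwDr.
have tbe : t * be = dotc g g - t.
  by rewrite /t; field; rewrite gt_eqF// ltr_pwDr.
have -> : - t * dotc g g + t ^+ 2 / 2 * be = - (t * dotc g g + t * t) / 2.
  have -> : t ^+ 2 / 2 * be = t / 2 * (t * be) by ring.
  by rewrite tbe; field.
have := mulr_gt0 t0 g0; have := mulr_gt0 t0 t0; lra.
Qed.

(** The orthogonal projection onto the kernel of [(A_ i)^T]. *)
Definition block_proj i : 'M[R]_N :=
  1%:M - A_ i *m invmx ((A_ i)^T *m A_ i) *m (A_ i)^T.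

Lemma trmx_mul_block_proj i : (A_ i)^T *m block_proj i = 0.
Proof.
by rewrite mulmxBr mulmx1 !mulmxA mulmxV ?gram_unit// mul1mx subrr.
Qed.

Lemma block_proj_mul i : block_proj i *m A_ i = 0.
Proof.
by rewrite mulmxBl mul1mx -!mulmxA mulVmx ?gram_unit// mulmx1 subrr.
Qed.

Lemma block_proj_orthoproj i : orthoproj (block_proj i).
Proof.
split.
  rewrite linearB/= trmx1 !trmx_mul trmxK trmx_inv trmx_mul trmxK.
  by rewrite mulmxA.
rewrite {1}/block_proj mulmxBl mul1mx -(mulmxA (A_ i *m _)).
by rewrite trmx_mul_block_proj mulmx0 subr0.
Qed.

(** In this variable block updates and multiplier decouple: an update acts on
    the gap by a linear map in which [b] and [s.2] do not appear. *)
Definition gap s : 'cV[R]_N := residual A_ b s.1 - s.2.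

(** The new gap is in the range of [block_proj i], by stationarity, and differs
    from the old one by a vector in the range of [A_ i], which
    [block_proj i] kills. *)
Lemma gap_update s i : gap (update A_ b s i) = block_proj i *m gap s.
Proof.
have [v0 [v0min _]] := block_minimizers_total b hA s.1 s.2 i.
rewrite /gap /update/=; set v := xget _ _.
have vmin : block_minimizers A_ b s.1 s.2 v.
  exact: xgetI v0min.
have st := block_minimizer_stationary vmin.
have uE : residual A_ b (set_block s.1 v) - s.2 =
    A_ i *m (v - submxcol s.1 i) + (residual A_ b s.1 - s.2).
  rewrite residual_set_block -[in RHS](set_block_id s.1 i).
  rewrite submxcol_set_block.
  rewrite [in RHS]residual_set_block mulmxBr.
  by rewrite !addrA subrK.
set w := _ - s.2 in st uE *.
have -> : w = block_proj i *m w.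
  by rewrite mulmxBl mul1mx -(mulmxA (A_ i *m _)) st mulmx0 subr0.
by rewrite {1}uE mulmxDr mulmxA block_proj_mul mul0mx add0r.
Qed.

(** The two phases over an arbitrary list of blocks. Its head is the first block
    of the forward phase and the last one of the backward phase, which permits
    induction on the list. *)
Definition sweep (e : 'I_n -> bool) (l : seq 'I_n) s : state :=
  foldl (fun s i => if ~~ e i then update A_ b s i else s)
    (foldl (fun s i => if e i then update A_ b s i else s) s l) (rev l).

Lemma sweep_cons e i l s : sweep e (i :: l) s =
  if e i then sweep e l (update A_ b s i) else update A_ b (sweep e l s) i.
Proof. by rewrite /sweep rev_cons foldl_rcons /=; case: (e i). Qed.

Lemma gap_sweep (e : {ffun 'I_n -> bool}) l s :
  gap (sweep e l s) = sweep_mx block_proj e l *m gap s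
  /\ (sweep e l s).2 = s.2.
Proof.
elim: l s => [|i l IH] s; first by rewrite mul1mx.
rewrite sweep_cons /=; case: (e i).
  have [-> ->] := IH (update A_ b s i).
  by rewrite gap_update mulmxA.
by have [h1 h2] := IH s; rewrite gap_update h1 mulmxA.
Qed.

Definition round_mx (e : {ffun 'I_n -> bool}) : 'M[R]_N :=
  sweep_mx block_proj e (enum 'I_n).

Lemma br_round_sweep e s :
  br_round A_ b e s = dual_update A_ b (sweep e (enum 'I_n) s).
Proof. by []. Qed.

Lemma br_round_dual (e : {ffun 'I_n -> bool}) s :
  (br_round A_ b e s).2 = - (round_mx e *m gap s).
Proof.
have [<- _] := gap_sweep e (enum 'I_n) s.
by rewrite br_round_sweep /gap opprB.
Qed.

Lemma br_round_gap (e : {ffun 'I_n -> bool}) s :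
  gap (br_round A_ b e s) = s.2 + 2 *: (round_mx e *m gap s).
Proof.
have [g_eq mu_eq] := gap_sweep e (enum 'I_n) s.
rewrite {1}/gap br_round_dual br_round_sweep /= -mu_eq /round_mx -g_eq /gap.
by apply/colP => j; rewrite !mxE; lra.
Qed.

Definition mean_mx : 'M[R]_N := mean_sweep block_proj (enum 'I_n).

Lemma mean_round_mx :
  \sum_(e : {ffun 'I_n -> bool}) 2^-1 ^+ n *: round_mx e = mean_mx.
Proof.
rewrite -scaler_sumr sum_sweep_mx ?enum_uniq// card_ord scalerA.
by rewrite natrX -exprMn mulVf ?expr1n ?scale1r.
Qed.

(** An equality case is fixed by every [block_proj i], hence orthogonal to the
    columns of the non-singular [\mxrow_i A_ i]. *)
Lemma dotc_mean_mx_lt (v : 'cV[R]_N) :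
  v != 0 -> dotc v (mean_mx *m v) < dotc v v.
Proof.
move=> v0; rewrite ltNge; apply: contra v0 => /mean_sweep_fix h.
have Av i : (A_ i)^T *m v = 0.
  rewrite -(h block_proj_orthoproj i) ?mem_enum//.
  by rewrite mulmxA trmx_mul_block_proj mul0mx.
apply/eqP/dotc_eq0; rewrite -{2}(mulKVmx hA v) -(submxcolK (invmx _ *m v)).
rewrite mul_mxrow_mxcol /dotc mulmx_sumr summxE big1// => i _.
by rewrite mulmxA -[A_ i]trmxK -trmx_mul Av trmx0 mul0mx mxE.
Qed.

(** At [x = A^-1 (b + mu)] the Lagrangian is [- |mu|^2], so the dual function is
    at most [- |mu|^2], while it vanishes at [mu = 0]. *)
Lemma primal_dual_optimalE :
  primal_dual_optimal A_ b = [set (invmx (\mxrow_i A_ i) *m b, 0)].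
Proof.
have feasE x : feasible A_ b x <-> x = invmx (\mxrow_i A_ i) *m b.
  have := residualE x; rewrite /residual /feasible => rE; split.
    by move: rE => /[swap] ->; rewrite subrr => /esym/eqP;
      rewrite subr_eq0 => /eqP <-; rewrite mulKmx.
  move=> xE; apply/eqP; rewrite -subr_eq0 rE xE mulKVmx// subrr//.
have lagE x mu : x = invmx (\mxrow_i A_ i) *m (b + mu) ->
    lagrangian A_ b x mu = - dotc mu mu.
  by move=> ->; rewrite /lagrangian residualE mulKVmx// addrC addKr.
have dual_le mu : (dual_function A_ b mu <= (- dotc mu mu)%:E)%E.
  apply: ereal_inf_lbound; exists (invmx (\mxrow_i A_ i) *m (b + mu)) => //.
  by rewrite /objective add0r lagE.
have dual0 : dual_function A_ b 0 = 0%E.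
  rewrite /dual_function (_ : [set _ | _ in _] = [set 0%E]) ?ereal_inf1//.
  rewrite /objective /lagrangian; apply/seteqP; split=> [_ [x _ <-]|_ ->] /=.
    by rewrite /dotc trmx0 mul0mx mxE oppr0 addr0.
  by exists 0 => //; rewrite /dotc trmx0 mul0mx mxE oppr0 addr0.
apply/seteqP; split => [[x mu] [/= [/feasE -> _]]|_ ->] /=.
  move=> /(_ 0); rewrite dual0 => /le_trans/(_ (dual_le mu)).
  rewrite lee_fin oppr_ge0 => mu0.
  suff -> : mu = 0 by [].
  by apply: dotc_eq0; apply/eqP; rewrite eq_le mu0 dotc_ge0.
split => /=; first by split; [exact/feasE|].
move=> mu; rewrite dual0; apply: le_trans (dual_le mu) _.
by rewrite lee_fin oppr_le0 dotc_ge0.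
Qed.

End Round.

(** * Expectations over the coins *)

Section CoinExpectation.
Variables (R : realType) (disp : measure_display) (T : measurableType disp).
Variable P : probability T R.

Lemma expectation_finite (F : finType) (X : T -> F) (g : F -> R) :
  (forall c, measurable (X @^-1` [set c])) ->
  ('E_P[fun w => g (X w)])%E = (\sum_c g c * fine (P (X @^-1` [set c])))%:E.
Proof.
move=> mX.
have intX c : P.-integrable setT (EFin \o (\1_(X @^-1` [set c]) : T -> R)).
  by apply: integrable_indic => //; rewrite fin_num_fun_lty.
rewrite unlock.
have -> : (fun w => (g (X w))%:E) = fun w =>
    (\sum_c (g c)%:E * (EFin \o (\1_(X @^-1` [set c]) : T -> R)) w)%E.
  apply/funext => w; rewrite (bigD1 (X w))//= indicE mem_set// mule1.
  rewrite big1 ?adde0// => c /eqP Xc.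
  by rewrite indicE memNset ?mule0//= => /esym.
rewrite integral_sum//; last by move=> c; exact: integrableZl.
rewrite -sumEFin; apply: eq_bigr => c _.
by rewrite integralZl// integral_indic// setIT EFinM fineK// fin_num_measure.
Qed.

Variables (n : nat) (xi : nat -> 'I_n -> {RV P >-> bool}).
Hypothesis hfair : forall k i, fair_coin P (xi k i).
Hypothesis hindep :
  mutually_independent P (fun ki : nat * 'I_n => xi ki.1 ki.2).

Definition cylinder k (a : nat -> 'I_n -> bool) : set T :=
  [set w | forall l i, (l < k)%N -> xi l i w = a l i].

Lemma cylinder_bigcap k a : cylinder k a =
  \bigcap_(j in [set` [seq (l, i) | l <- iota 0 k, i <- enum 'I_n]])
    (xi j.1 j.2 @^-1` [set a j.1 j.2]).
Proof.
apply/seteqP; split=> [w h j /allpairsP[[l i] [/=]]|w h l i lk].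
  by rewrite mem_iota add0n /= => lk _ ->; exact: h.
apply: (h (l, i)); apply/allpairsP; exists (l, i); split => //=.
  by rewrite mem_iota.
by rewrite mem_enum.
Qed.

Lemma measurable_cylinder k a : measurable (cylinder k a).
Proof.
rewrite cylinder_bigcap; apply: fin_bigcap_measurable => // j _.
by rewrite -[X in measurable X]setTI; exact: measurable_funPT.
Qed.

Lemma probability_cylinder k a : P (cylinder k a) = (2^-1 ^+ (k * n))%:E.
Proof.
rewrite cylinder_bigcap.
rewrite (hindep (B := fun j => [set a j.1 j.2]))//; last first.
  by apply: allpairs_uniq => [||[? ?] [? ?]]; rewrite ?iota_uniq ?enum_uniq.
rewrite (eq_bigr (fun=> (2^-1)%:E)) => [|j _]; last first.
  by have [h1 h0] := hfair j.1 j.2; case: (a j.1 j.2).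
rewrite prodEFin big_const_seq count_predT size_allpairs size_iota.
by rewrite size_enum_ord -Monoid.iteropE.
Qed.

(** The coins of the first [k] rounds are [c]; those of every later round are
    [e]. *)
Definition extend_coins k (c : {ffun 'I_k * 'I_n -> bool})
    (e : {ffun 'I_n -> bool}) (l : nat) (i : 'I_n) : bool :=
  if insub l is Some l' then c (l', i) else e i.

Definition round_coins k (w : T) : {ffun 'I_n -> bool} := [ffun i => xi k i w].

Lemma coin_history_cylinder k c e :
  coin_history xi k @^-1` [set c] = cylinder k (extend_coins c e).
Proof.
apply/seteqP; split=> w /=.
  by move=> <- l i lk; rewrite /extend_coins insubT ffunE.
move=> h; apply/ffunP => -[l i]; rewrite ffunE /= h//.
by rewrite /extend_coins valK.
Qed.

(** The past and the coins of round [k] together are the history up to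
    [k.+1]; this carries the independence of the two. *)
Lemma coin_history_round_cylinder k c e :
  (fun w => (coin_history xi k w, round_coins k w)) @^-1` [set (c, e)] =
  cylinder k.+1 (extend_coins c e).
Proof.
apply/seteqP; split=> w /=.
  move=> [<- <-] l i; rewrite ltnS leq_eqVlt => /predU1P[->|lk].
    by rewrite /extend_coins insubN ?ltnn// ffunE.
  by rewrite /extend_coins insubT ffunE.
move=> h; congr pair; apply/ffunP.
  move=> [l i]; rewrite ffunE /= h ?ltnS 1?ltnW//.
  by rewrite /extend_coins valK.
by move=> i; rewrite ffunE h// /extend_coins insubN ?ltnn.
Qed.

Variables (d : 'I_n -> nat).
Local Notation N := (\sum_(i < n) d i)%N.
Variables (A_ : forall i : 'I_n, 'M[R]_(N, d i)) (b : 'cV[R]_N).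
Local Notation state := ('cV[R]_N * 'cV[R]_N)%type.
Variable (s0 : state).

Definition iterate k (w : T) : state := br_admm A_ b (fun l i => xi l i w) s0 k.

Definition history_iterate k (c : {ffun 'I_k * 'I_n -> bool}) : state :=
  br_admm A_ b (extend_coins c [ffun=> false]) s0 k.

Lemma iterate_history k w : iterate k w = history_iterate (coin_history xi k w).
Proof.
apply: eq_br_admm => l i lk.
by rewrite /extend_coins insubT ffunE.
Qed.

Lemma iterate_step k w : iterate k.+1 w =
  br_round A_ b (round_coins k w) (history_iterate (coin_history xi k w)).
Proof.
rewrite -iterate_history /iterate /=; congr br_round.
by apply/funext => i; rewrite ffunE.
Qed.

Variables (m : nat) (f : state -> 'cV[R]_m).

Lemma expectation_iterate k : expectation_vec P (fun w => f (iterate k w)) =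
  \sum_(c : {ffun 'I_k * 'I_n -> bool})
    2^-1 ^+ (k * n) *: f (history_iterate c).
Proof.
apply/colP => j; rewrite !mxE summxE.
under eq_fun do rewrite iterate_history.
have cyl c := coin_history_cylinder c [ffun=> false].
rewrite (@expectation_finite _ (coin_history xi k)
  (fun c => f (history_iterate c) j ord0)) => [/=|c]; last first.
  by rewrite cyl; exact: measurable_cylinder.
apply: eq_bigr => c _.
by rewrite cyl probability_cylinder mulrC !mxE.
Qed.

(** Conditioning on the past: the coins of the last round are averaged first,
    uniformly and for each history separately. *)
Lemma expectation_iterate_step k :
  expectation_vec P (fun w => f (iterate k.+1 w)) =
  \sum_(c : {ffun 'I_k * 'I_n -> bool}) 2^-1 ^+ (k * n) *:
    \sum_(e : {ffun 'I_n -> bool})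
      2^-1 ^+ n *: f (br_round A_ b e (history_iterate c)).
Proof.
apply/colP => j; rewrite !mxE summxE.
under eq_fun do rewrite iterate_step.
rewrite (@expectation_finite _
  (fun w => (coin_history xi k w, round_coins k w))
  (fun ce => f (br_round A_ b ce.2 (history_iterate ce.1)) j ord0))
  => [/=|[c e]]; last first.
  by rewrite coin_history_round_cylinder; exact: measurable_cylinder.
rewrite (eq_bigr (fun ce : {ffun 'I_k * 'I_n -> bool} * {ffun 'I_n -> bool} =>
     2^-1 ^+ (k * n) * (2^-1 ^+ n *
    f (br_round A_ b ce.2 (history_iterate ce.1)) j ord0))) => [|[c e] _].
  rewrite -(pair_bigA _ (fun c (e : {ffun 'I_n -> bool}) =>
    2^-1 ^+ (k * n) * (2^-1 ^+ n *
    f (br_round A_ b e (history_iterate c)) j ord0))).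
  apply: eq_bigr => c _; rewrite -mulr_sumr !mxE summxE.
  by congr (_ * _); apply: eq_bigr => e _; rewrite !mxE.
rewrite coin_history_round_cylinder probability_cylinder /=.
by rewrite mulrA -exprD mulSn addnC mulrC.
Qed.

End CoinExpectation.

(** * The mean iterates *)

Section MeanIterates.
Variables (R : realType) (disp : measure_display) (T : measurableType disp).
Variables (P : probability T R) (n : nat) (d : 'I_n -> nat).
Local Notation N := (\sum_(i < n) d i)%N.
Variables (A_ : forall i : 'I_n, 'M[R]_(N, d i)) (b : 'cV[R]_N).
Hypothesis hA : \mxrow_i A_ i \in unitmx.
Variable xi : nat -> 'I_n -> {RV P >-> bool}.
Hypothesis hfair : forall k i, fair_coin P (xi k i).
Hypothesis hindep :
  mutually_independent P (fun ki : nat * 'I_n => xi ki.1 ki.2).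
Variable s0 : 'cV[R]_N * 'cV[R]_N.

Definition mean_of (f : 'cV[R]_N * 'cV[R]_N -> 'cV[R]_N) k : 'cV[R]_N :=
  expectation_vec P (fun w => f (iterate xi A_ b s0 k w)).

Local Notation mean_gap := (mean_of (gap A_ b)).
Local Notation M := (mean_mx A_).

Lemma mean_dual_step k : mean_of snd k.+1 = - (M *m mean_gap k).
Proof.
rewrite /mean_of expectation_iterate_step// expectation_iterate//.
rewrite mulmx_sumr -sumrN; apply: eq_bigr => c _.
rewrite -scalemxAr -scalerN; congr (_ *: _).
rewrite -mean_round_mx mulmx_suml -sumrN; apply: eq_bigr => e _.
by rewrite br_round_dual// -scalemxAl scalerN.
Qed.

Lemma sum_coin_weights (I : finType) :
  \sum_(e : {ffun I -> bool}) 2^-1 ^+ #|I| = 1 :> R.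
Proof.
rewrite sumr_const card_ffun card_bool -[_ *+ _]mulr_natr natrX -exprMn.
by rewrite mulVf ?expr1n.
Qed.

Lemma mean_gap_step k : mean_gap k.+1 = mean_of snd k + 2 *: (M *m mean_gap k).
Proof.
rewrite /mean_of expectation_iterate_step// !expectation_iterate//.
rewrite mulmx_sumr scaler_sumr -big_split/=; apply: eq_bigr => c _.
rewrite -scalemxAr scalerA mulrC -scalerA -scalerDr; congr (_ *: _).
set s := history_iterate _ _ _ _.
have w1 := sum_coin_weights 'I_n; rewrite card_ord in w1.
rewrite [LHS](eq_bigr (fun e : {ffun 'I_n -> bool} => 2^-1 ^+ n *: s.2 +
    2^-1 ^+ n *: (2 *: (round_mx A_ e *m gap A_ b s)))); last first.
  by move=> e _; rewrite br_round_gap// scalerDr.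
rewrite [LHS]big_split/= -scaler_suml w1 scale1r; congr (_ + _).
rewrite -mean_round_mx mulmx_suml scaler_sumr; apply: eq_bigr => e _.
by rewrite -scalemxAl !scalerA mulrC.
Qed.

(** The residual is affine in the primal point, so its mean determines the mean
    primal point. *)
Lemma mean_primal k :
  mean_of fst k = invmx (\mxrow_i A_ i) *m (b + mean_gap k + mean_of snd k).
Proof.
apply: (canRL (mulKmx hA)).
have bE : b = \sum_(c : {ffun 'I_k * 'I_n -> bool}) 2^-1 ^+ (k * n) *: b.
  have := sum_coin_weights ('I_k * 'I_n)%type.
  by rewrite card_prod !card_ord -scaler_suml => ->; rewrite scale1r.
rewrite [X in _ = X + _ + _]bE /mean_of !expectation_iterate// mulmx_sumr.
rewrite -!big_split/=.
apply: eq_bigr => c _; rewrite -scalemxAr -!scalerDr; congr (_ *: _).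
by rewrite /gap residualE -[RHS]addrA subrK addrC subrK.
Qed.

Lemma mean_gap_cvg0 : mean_gap k @[k --> \oo] --> (0 : 'cV[R]_N).
Proof.
apply: (@two_step_cvg0 _ _ M).
- exact/trmx_mean_sweep/block_proj_orthoproj.
- exact/mean_sweep_nonexpansive/block_proj_orthoproj.
- by move=> v; exact/mean_sweep_lower/block_proj_orthoproj.
- by move=> v; exact: dotc_mean_mx_lt.
- by move=> k; rewrite mean_gap_step mean_dual_step addrC.
Qed.

Lemma mean_dual_cvg0 : mean_of snd k @[k --> \oo] --> (0 : 'cV[R]_N).
Proof.
rewrite -(cvg_shiftS (mean_of snd)) (_ : (fun k => mean_of snd k.+1) =
  fun k => - M *m mean_gap k); last first.
  by apply/funext => k; rewrite mean_dual_step mulNmx.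
by have := cvg_mulmxl (B := - M) mean_gap_cvg0; rewrite mulmx0.
Qed.

Lemma mean_primal_cvg :
  mean_of fst k @[k --> \oo] --> invmx (\mxrow_i A_ i) *m b.
Proof.
under eq_cvg do rewrite mean_primal.
apply: cvg_mulmxl.
have h : b + mean_gap k + mean_of snd k @[k --> \oo] --> (b + 0 + 0 : 'cV[R]_N).
  apply: cvgD; last exact: mean_dual_cvg0.
  by apply: cvgD; [exact: cvg_cst|exact: mean_gap_cvg0].
by rewrite !addr0 in h.
Qed.

Lemma mean_iterate_cvg :
  col_mx (mean_of fst k) (mean_of snd k) @[k --> \oo] -->
    (col_mx (invmx (\mxrow_i A_ i) *m b) 0 : 'cV[R]_(N + N)).
Proof.
have coord (f : nat -> 'cV[R]_N) (l : 'cV[R]_N) j : f k @[k --> \oo] --> l ->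
    f k j ord0 @[k --> \oo] --> (l j ord0 : R).
  move=> fl; apply: (cvg_comp f (fun v : 'cV[R]_N => v j ord0) fl).
  exact: coord_continuous.
apply: cvg_mx_coord => i j; rewrite ord1 mxE; under eq_cvg do rewrite mxE.
case: (fintype.split i) => i'; apply: coord.
  exact: mean_primal_cvg.
exact: mean_dual_cvg0.
Qed.

End MeanIterates.

Theorem proposition1 (R : realType) (n : nat) (d : 'I_n -> nat)
  (A_ : forall i : 'I_n, 'M[R]_((\sum_(j < n) d j)%N, d i))
  (b : 'cV[R]_(\sum_(j < n) d j)%N)
  (hA : \mxrow_i A_ i \in unitmx)
  (disp : measure_display) (T : measurableType disp) (P : probability T R)
  (xi : nat -> 'I_n -> {RV P >-> bool})
  (hfair : forall k i, fair_coin P (xi k i))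
  (hindep : mutually_independent P (fun ki : nat * 'I_n => xi ki.1 ki.2))
  (x0 mu0 : 'cV[R]_(\sum_(j < n) d j)%N) :
  let y (k : nat) (w : T) :=
    let s := br_admm A_ b (fun l i => xi l i w) (x0, mu0) k in
    col_mx s.1 s.2 in
  let xstar := invmx (\mxrow_i A_ i) *m b in
  primal_dual_optimal A_ b = [set (xstar, 0)] /\
  expectation_vec P (y k) @[k --> \oo] --> col_mx xstar 0.
Proof.
move=> y xstar; split; first exact: primal_dual_optimalE.
rewrite (_ : (fun k => expectation_vec P (y k)) = fun k =>
    col_mx (expectation_vec P (fun w => (iterate xi A_ b (x0, mu0) k w).1))
      (expectation_vec P (fun w => (iterate xi A_ b (x0, mu0) k w).2))).
  exact: mean_iterate_cvg.
apply/funext => k; apply/colP => j; rewrite !mxE.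
case: (fintype.splitP j) => i ji; rewrite mxE.
  congr (fine _); congr (expectation _ _); apply/funext => w.
  by rewrite (_ : j = lshift _ i) ?col_mxEu//; exact: val_inj.
congr (fine _); congr (expectation _ _); apply/funext => w.
by rewrite (_ : j = rshift _ i) ?col_mxEd//; exact: val_inj.
Qed.
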